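(* Let $\Bbbk$ be a field of characteristic zero and let $m\ge 3$ be an integer. Then the artinian algebra $A(T_{m,3})$ has the weak Lefschetz property if and only if $m\in\{3,4,5,6,7,8,10,11,14\}$.
   Context: For integers $m\ge 3$, $n\ge 1$, the tadpole graph $T_{m,n}$ is the simple graph with vertex set $\{x_1,\dots,x_m,y_1,\dots,y_n\}$ and edges $\{x_i,x_{i+1}\}$ for $1\le i\le m-1$, $\{x_m,x_1\}$ (so the $x_i$ form an $m$-cycle), $\{y_j,y_{j+1}\}$ for $1\le j\le n-1$ (so the $y_j$ form a path), and the bridge $\{x_m,y_1\}$. For a simple graph $G$ on vertices $1,\dots,N$, let $R=\Bbbk[x_1,\dots,x_N]$ be the standard graded polynomial ring, $I(G)=(x_ix_j : \{i,j\}\text{ an edge of }G)$ its edge ideal, and $A(G)=R/\big((x_1^2,\dots,x_N^2)+I(G)\big)$, a standard graded artinian algebra $A=\bigoplus_{j=0}^s [A]_j$. Such an $A$ has the weak Lefschetz property (WLP) if there is a linear form $\ell\in[A]_1$ such that multiplication $\times\ell:[A]_j\to[A]_{j+1}$ is injective or surjective for every $j=0,\dots,s-1$. *)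

(* Defs.v *)
From HB Require Import structures.
From mathcomp Require Import all_boot all_order all_algebra.
From mathcomp Require Import mpoly.

Set Implicit Arguments.
Unset Strict Implicit.
Unset Printing Implicit Defensive.

Import GRing.Theory.
Local Open Scope ring_scope.

(* A simple graph on vertices 'I_N is given by a relation [adj]
   (assumed symmetric and irreflexive by the callers). *)

Definition in_AG_ideal (k : fieldType) (N : nat) (adj : rel 'I_N)
    (p : {mpoly k[N]}) : Prop :=
  exists (h : 'I_N -> {mpoly k[N]}) (e : 'I_N -> 'I_N -> {mpoly k[N]}),
    p = \sum_(i < N) h i * ('X_i * 'X_i)
        + \sum_(i < N) \sum_(j < N | adj i j) e i j * ('X_i * 'X_j).

Arguments in_AG_ideal : clear implicits.

(* Weak Lefschetz property of A(G) = R / ((x_i^2) + I(G)).  Since the ideal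
   is homogeneous, [A]_j = R_j / (ideal)_j, and multiplication by the linear
   form l : [A]_j -> [A]_{j+1} is
   - injective iff for homogeneous f of degree j, l f in ideal -> f in ideal;
   - surjective iff every homogeneous g of degree j+1 is congruent to l f for
     some homogeneous f of degree j.
   Quantifying over all j (rather than j < s) is harmless since [A]_{j+1} = 0
   for j >= s, so surjectivity is automatic there. *)
Definition has_WLP (k : fieldType) (N : nat) (adj : rel 'I_N) : Prop :=
  exists l : {mpoly k[N]},
    l \is 1.-homog /\
    forall j : nat,
      (forall f : {mpoly k[N]}, f \is j.-homog ->
          in_AG_ideal k N adj (l * f) -> in_AG_ideal k N adj f)
      \/
      (forall g : {mpoly k[N]}, g \is j.+1.-homog ->
          exists f : {mpoly k[N]}, f \is j.-homog /\ in_AG_ideal k N adj (g - l * f)).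

(* Tadpole graph T_{m,n} on 'I_(m+n), 0-based:
   x_i  (1 <= i <= m) is vertex i-1,  y_j (1 <= j <= n) is vertex m+j-1.
   Edges: {x_i,x_{i+1}} (i.e. {a,a+1} for a+1 < m), {x_m,x_1} (i.e. {m-1,0}),
   {y_j,y_{j+1}} (i.e. {a,a+1} for m <= a, a+1 < m+n), bridge {x_m,y_1}
   (i.e. {m-1,m}). *)
Definition tadpole_edge (m n a b : nat) : bool :=
  [|| (a.+1 == b) && (b < m)%N,
      (a == m.-1) && (b == 0%N),
      (a.+1 == b) && (m <= a)%N && (b < m + n)%N
    | (a == m.-1) && (b == m)].

Definition tadpole (m n : nat) : rel 'I_(m + n) :=
  fun u v => tadpole_edge m n (val u) (val v) || tadpole_edge m n (val v) (val u).

Arguments tadpole : clear implicits.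
Arguments has_WLP : clear implicits.

(* Main.v *)
(* On the basis of independent sets, multiplication by a linear form from degree
   [j] to [j+1] is a matrix; in characteristic 0 its rank is largest for the sum
   of the variables (deform the form to one with nonzero coefficients, then
   rescale the variables), so the WLP says that this one form has maximal rank
   in every degree.

   Failure: if [{a_1,b_1}, ..., {a_d,b_d}] are disjoint pairs of vertices without
   edges between different pairs, then [\prod_i (x_{a_i} - x_{b_i})] is killed by
   the sum of the partial derivatives, hence is orthogonal to the image of the map
   from degree [d-1] to [d].  Take [d = m %/ 3 + 1].  One such product exists, from
   an induced matching, so the map is not surjective; it is not injective either
   as soon as [dim A_{d-1} >= dim A_d], which holds for all [m] outside the list
   except 13, 17 and 20.  In these three cases
   [dim A_d - dim A_{d-1}] is 32, 394 and 105, and there are more linearly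
   independent products than that.

   Success: Gaussian elimination modulo 7 shows that every map has maximal rank
   over ['F_7], hence in characteristic 0. *)

Require Import Defs.
From HB Require Import structures.
From mathcomp Require Import all_boot all_order all_algebra.
From mathcomp Require Import mpoly zify.
From Stdlib Require BinNat Nnat.

Set Implicit Arguments.
Unset Strict Implicit.
Unset Printing Implicit Defensive.

Import GRing.Theory.
Local Open Scope ring_scope.

(** * The multiplication matrices *)

Section Faces.
Variables (N : nat) (adj : rel 'I_N).

Definition indep (S : {set 'I_N}) :=
  [forall i in S, forall j in S, adj i j ==> (i == j)].

Definition faces (j : nat) : {set {set 'I_N}} := [set S | indep S & #|S| == j].

Definition face (j : nat) (s : 'I_#|faces j|) : {set 'I_N} := enum_val s.

(** Homogeneous elements are row vectors, multiplied on the right. The sum has at most one term: it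
    is [a i] when [face t] is [face s] with [i] added, so no choice of [i] is needed. *)
Definition lef_mx (R : pzSemiRingType) (a : 'I_N -> R) (j : nat) :
    'M[R]_(#|faces j|, #|faces j.+1|) :=
  \matrix_(s, t) \sum_(i in face t | face t :\ i == face s) a i.

Definition monom (S : {set 'I_N}) : 'X_{1..N} := [multinom (i \in S : nat) | i < N].

Implicit Types S T : {set 'I_N}.

Lemma indepS S T : S \subset T -> indep T -> indep S.
Proof.
move=> /subsetP sST /forall_inP iT; apply/forall_inP => i iS.
by apply/forall_inP => j jS; have /forall_inP := iT i (sST i iS); apply; exact: sST.
Qed.

Lemma monom_inj : injective monom.
Proof.
move=> S T /mnmP eST; apply/setP => i.
by have := eST i; rewrite !mnmE; case: (i \in S); case: (i \in T).
Qed.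

Lemma mdeg_monom S : mdeg (monom S) = #|S|.
Proof.
rewrite mdegE -sum1_card [RHS]big_mkcond /=.
by apply: eq_bigr => i _; rewrite mnmE; case: (i \in S).
Qed.

Lemma monomD1 (T : {set 'I_N}) i :
  i \in T -> monom T = (U_(i) + monom (T :\ i))%MM.
Proof.
move=> iT; apply/mnmP => j; rewrite mnmDE mnm1E !mnmE in_setD1.
by rewrite eq_sym; case: eqVneq => [->|_]; rewrite ?iT.
Qed.

Section Ideal.
Variable k : fieldType.
Implicit Types p q : {mpoly k[N]}.
Notation ideal := (in_AG_ideal k N adj).

Lemma ideal0 : ideal 0.
Proof.
exists (fun _ => 0), (fun _ _ => 0).
rewrite big1 => [|i _]; last by rewrite mul0r.
by rewrite add0r big1 // => i _; rewrite big1 // => j _; rewrite mul0r.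
Qed.

Lemma idealD p q : ideal p -> ideal q -> ideal (p + q).
Proof.
move=> [h [e ->]] [h' [e' ->]].
exists (fun i => h i + h' i), (fun i j => e i j + e' i j).
rewrite addrACA; congr (_ + _); rewrite -big_split; apply: eq_bigr => i _ /=.
  by rewrite mulrDl.
by rewrite -big_split; apply: eq_bigr => j _; rewrite mulrDl.
Qed.

Lemma ideal_gen q i j : (i == j) || adj i j -> ideal (q * ('X_i * 'X_j)).
Proof.
case: (eqVneq i j) => [<- _|_ /= ij].
  exists (fun l => if l == i then q else 0), (fun _ _ => 0).
  rewrite (bigD1 i) //= eqxx big1 => [|l /negPf->]; last by rewrite mul0r.
  rewrite [X in _ + X]big1 ?addr0 // => l _.
  by rewrite big1 // => l' _; rewrite mul0r.
exists (fun _ => 0), (fun l l' => if (l == i) && (l' == j) then q else 0).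
rewrite big1 ?add0r => [|l _]; last by rewrite mul0r.
rewrite (bigD1 i) //= [X in _ + X]big1 ?addr0 => [|l /negPf li]; last first.
  by rewrite big1 // => l' _; rewrite li mul0r.
rewrite (bigD1 j) //= !eqxx /= big1 ?addr0 // => l /andP[_ /negPf->].
by rewrite mul0r.
Qed.

Lemma mcoeffMX_nle p m l : ~~ (m <= l)%MM -> (p * 'X_[m])@_l = 0.
Proof.
move=> nml; rewrite mcoeffM big1 // => -[m1 m2] /= /eqP lE.
rewrite mcoeffX; case: eqVneq => [mE|_]; last by rewrite mulr0.
by case/negP: nml; rewrite [X in (_ <= X)%MM]lE mE lem_addl.
Qed.

(** This is a monomial ideal, so membership is decided monomial by monomial. A monomial divisible by
    no generator is squarefree with independent support. *)
Lemma idealP p : ideal p <-> forall S, indep S -> p@_(monom S) = 0.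
Proof.
split=> [[h [e ->]] S iS|p0].
  have gen0 q i j : (i == j) || adj i j -> (q * ('X_i * 'X_j))@_(monom S) = 0.
    move=> ij; rewrite -mpolyXD mcoeffMX_nle //; apply/negP => /mnm_lepP le.
    have := le i; have := le j; rewrite !mnmDE !mnm1E !mnmE !eqxx.
    case: (eqVneq i j) ij => [->|nij /= ij]; first by case: (j \in S).
    case jS: (j \in S) => //; case iS': (i \in S) => //.
    move/forall_inP: iS => /(_ _ iS') /forall_inP /(_ _ jS).
    by rewrite ij (negPf nij).
  rewrite mcoeffD !raddf_sum /= big1 => [|i _]; last by rewrite gen0 ?eqxx.
  rewrite add0r big1 // => i _; rewrite raddf_sum big1 //= => j ij.
  by rewrite gen0 ?ij ?orbT.
rewrite (mpolyE p); apply: (big_ind ideal) => [||m _]; [exact: ideal0|exact: idealD|].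
have [->|pm] := eqVneq p@_m 0; first by rewrite scale0r; exact: ideal0.
(* It suffices that a generator divides each monomial of [p]: a square if some exponent exceeds 1,
   otherwise an edge inside the support. *)
suff [i [j [ij le]]] : exists i j, (i == j) || adj i j /\ (U_(i) + U_(j) <= m)%MM.
  rewrite -(submK le) mpolyXD [X in _ * X]mpolyXD scalerAl.
  exact: ideal_gen.
case: (boolP [exists i, (1 < m i)%N]) => [/existsP[i mi]|].
  exists i, i; rewrite eqxx; split=> //; apply/mnm_lepP => l.
  by rewrite mnmDE mnm1E; case: eqVneq => [<-|].
rewrite negb_exists => /forallP small.
have mE : m = monom [set i | (0 < m i)%N].
  apply/mnmP => i; rewrite mnmE inE; have := small i.
  by case: (m i) => [|[]].
have : ~~ indep [set i | (0 < m i)%N].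
  by apply: contra pm => iS; rewrite mE p0.
case/forall_inPn => i; rewrite inE => mi /forall_inPn[j]; rewrite inE => mj.
rewrite negb_imply => /andP[ij nij]; exists i, j; rewrite ij orbT; split=> //.
apply/mnm_lepP => l; rewrite mnmDE !mnm1E; case: (eqVneq i l) => [<-|_].
  by rewrite eq_sym (negPf nij).
by case: eqVneq => [<-|].
Qed.

Definition linform (a : 'I_N -> k) : {mpoly k[N]} := \sum_i a i *: 'X_i.

Lemma linform_homog a : linform a \is 1.-homog.
Proof.
by apply: rpred_sum => i _; apply: dhomogZ; rewrite dhomogX /= mdeg1.
Qed.

Lemma homog1_linform (l : {mpoly k[N]}) :
  l \is 1.-homog -> l = linform (fun i => l@_(U_(i))).
Proof.
move=> lh; apply/mpolyP => m; rewrite raddf_sum /=.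
have [/mdeg1P[i /eqP->]|m1] := boolP (mdeg m == 1%N).
  rewrite (bigD1 i) //= big1 ?addr0 => [|j ji]; rewrite mcoeffZ mcoeffXU.
    by rewrite eqxx mulr1.
  by rewrite (negPf ji) mulr0.
rewrite (dhomog_nemf_coeff lh m1) big1 // => i _; rewrite mcoeffZ mcoeffX.
have /negPf-> : U_(i)%MM != m by apply: contraNneq m1 => <-; rewrite mdeg1.
by rewrite mulr0.
Qed.

Lemma linform_coef a (f : {mpoly k[N]}) T :
  (linform a * f)@_(monom T) = \sum_(i in T) a i * f@_(monom (T :\ i)).
Proof.
rewrite mulr_suml raddf_sum [RHS]big_mkcond /=; apply: eq_bigr => i _.
rewrite -scalerAl mcoeffZ mulrC; case: ifPn => iT.
  by rewrite mulrC (monomD1 iT) mulrC mulrC [_ * f]mulrC mcoeffMX.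
rewrite [_ * f]mulrC mcoeffMX_nle ?mul0r //; apply/negP => /mnm_lepP/(_ i).
by rewrite mnm1E eqxx mnmE (negPf iT).
Qed.

Lemma faceP j (s : 'I_#|faces j|) : indep (face s) /\ #|face s| = j.
Proof. by have := enum_valP s; rewrite inE => /andP[? /eqP]. Qed.

Lemma face_surj j S : S \in faces j -> exists s : 'I_#|faces j|, S = face s.
Proof. by move=> Sj; exists (enum_rank_in Sj S); rewrite /face enum_rankK_in. Qed.

Lemma face_inj j : injective (@face j).
Proof. exact: enum_val_inj. Qed.

Lemma mul_lef_mx (a : 'I_N -> k) j (g : {set 'I_N} -> k) t :
  ((\row_s g (face s)) *m lef_mx a j) 0 t
    = \sum_(i in face t) a i * g (face t :\ i).
Proof.
rewrite mxE; under eq_bigr => s _ do rewrite !mxE big_distrr /= big_mkcondr /=.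
rewrite exchange_big /=; apply: eq_bigr => i it.
have [/indepS ind ct] := faceP t.
have /face_surj[s sE] : face t :\ i \in faces j.
  by have := cardsD1 i (face t); rewrite ct it inE ind ?subD1set //= add1n => /succn_inj <-.
rewrite (bigD1 s) //= sE eqxx big1 ?addr0 1?mulrC // => s' /negPf s's.
by rewrite (inj_eq (@face_inj j)) eq_sym s's.
Qed.

Lemma homog_row (g : {set 'I_N} -> k) j :
  exists2 f : {mpoly k[N]}, f \is j.-homog & forall S, S \in faces j -> f@_(monom S) = g S.
Proof.
exists (\sum_(S in faces j) g S *: 'X_[monom S]).
  apply: rpred_sum => S; rewrite inE => /andP[_ /eqP Sj].
  by apply: dhomogZ; rewrite dhomogX /= mdeg_monom Sj.
move=> S Sj; rewrite raddf_sum (bigD1 S) //= big1 ?addr0 => [|T /andP[_ TS]];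
  rewrite mcoeffZ mcoeffX (inj_eq monom_inj) ?eqxx ?mulr1 //.
by rewrite (negPf TS) mulr0.
Qed.

Lemma homog_idealP j f : f \is j.-homog ->
  ideal f <-> \row_(s < #|faces j|) f@_(monom (face s)) = 0.
Proof.
move=> fj; rewrite idealP; split=> [f0|/rowP f0 S iS].
  by apply/rowP => s; rewrite !mxE f0 //; case: (faceP s).
have [Sj|nSj] := eqVneq #|S| j; last first.
  by rewrite (dhomog_nemf_coeff fj) //= mdeg_monom.
have /face_surj[s ->] : S \in faces j by rewrite inE iS Sj eqxx.
by have := f0 s; rewrite !mxE.
Qed.

Lemma linform_row a j (f : {mpoly k[N]}) :
  \row_(t < #|faces j.+1|) (linform a * f)@_(monom (face t))
    = (\row_s f@_(monom (face s))) *m lef_mx a j.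
Proof. by apply/rowP => t; rewrite mxE linform_coef (mul_lef_mx a (fun S => f@_(monom S))). Qed.

(** Together with [homog_row], this lifts every row vector to a homogeneous polynomial. *)
Lemma row_faceE j (u : 'rV[k]_#|faces j|) : exists g : {set 'I_N} -> k, u = \row_s g (face s).
Proof.
exists (fun S => \sum_(s | face s == S) u 0 s); apply/rowP => s; rewrite mxE.
rewrite (bigD1 s) //= big1 ?addr0 // => s' /andP[/eqP/face_inj-> /negP[]].
exact: eqxx.
Qed.

Lemma has_WLP_mx :
  has_WLP k N adj <->
  exists a : 'I_N -> k, forall j, row_free (lef_mx a j) || row_full (lef_mx a j).
Proof.
have homogM a j f : f \is j.-homog -> linform a * f \is j.+1.-homog.
  exact: dhomogM (linform_homog a).
split=> [[l [/homog1_linform-> wlp]]|[a wlp]]; last first.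
  exists (linform a); split=> [|j]; first exact: linform_homog.
  case/orP: (wlp j) => [free|full]; [left|right].
    move=> f fj /(homog_idealP (homogM _ _ _ fj)); rewrite linform_row => uM0.
    apply/(homog_idealP fj); apply: (row_free_inj free); by rewrite uM0 mul0mx.
  move=> g gj; have /submxP[u uM] := submx_full (\row_t g@_(monom (face t))) full.
  have [h hE] := row_faceE u; have [f fj fE] := homog_row h j.
  exists f; split=> //; apply/(homog_idealP (rpredB gj (homogM _ _ _ fj))).
  have uE : u = \row_s f@_(monom (face s)).
    by rewrite hE; apply/rowP => s; rewrite !mxE fE ?enum_valP.
  move/rowP: uM => uM; apply/rowP => t; have := uM t.
  by rewrite uE -linform_row !mxE mcoeffB => ->; rewrite subrr.
exists (fun i => l@_(U_(i))) => j; apply/orP; case: (wlp j) => [inj|surj]; [left|right].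
  rewrite -kermx_eq0; apply/rowV0P => u /sub_kermxP.
  have [h hE] := row_faceE u; have [f fj fE] := homog_row h j.
  have -> : u = \row_s f@_(monom (face s)).
    by rewrite hE; apply/rowP => s; rewrite !mxE fE ?enum_valP.
  rewrite -linform_row => /(homog_idealP (homogM _ _ _ fj)) /(inj f fj).
  by move/(homog_idealP fj).
rewrite -sub1mx; apply/row_subP => r; have [h hE] := row_faceE (row r 1%:M).
have [g gj gE] := homog_row h j.+1; have [f [fj]] := surj g gj.
move/(homog_idealP (rpredB gj (homogM _ _ _ fj)))/rowP => e0.
apply/submxP; exists (\row_s f@_(monom (face s))).
rewrite -linform_row hE; apply/rowP => t; have := e0 t; rewrite !mxE mcoeffB.
by move/eqP; rewrite subr_eq0 => /eqP <-; rewrite gE ?enum_valP.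
Qed.
End Ideal.
End Faces.

(** * Ranks *)

Lemma exists_minor (F : fieldType) p q (A : 'M[F]_(p, q)) :
  exists (f : 'I_(\rank A) -> 'I_p) (g : 'I_(\rank A) -> 'I_q), \det (mxsub f g A) != 0.
Proof.
have fullA : row_full (rowsub (maxrankfun A) A)^T.
  by rewrite /row_full mxrank_tr; exact: maxrowsub_free.
exists (maxrankfun A), (fullrankfun fullA); have := fullrowsub_unit fullA.
rewrite unitmxE unitfE -det_tr; congr (\det _ != 0).
by apply/matrixP => i j; rewrite !mxE.
Qed.

Lemma minor_rank (F : fieldType) p q r (A : 'M[F]_(p, q)) (f : 'I_r -> 'I_p) (g : 'I_r -> 'I_q) :
  \det (mxsub f g A) != 0 -> (r <= \rank A)%N.
Proof.
rewrite -unitfE -unitmxE => /mxrank_unit <-.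
have -> : mxsub f g A = rowsub f 1%:M *m A *m colsub g 1%:M.
  by rewrite mulmx_colsub mulmx1 mul_rowsub_mx mul1mx; apply/matrixP=> i j; rewrite !mxE.
exact: leq_trans (mxrankM_maxl _ _) (mxrankM_maxr _ _).
Qed.

(** A minor that is nonzero in [F] is the image of a nonzero integer, which stays nonzero in
    characteristic 0. *)
Lemma rank_map_intr_le (F k : fieldType) p q (A : 'M[int]_(p, q)) :
  [pchar k] =i pred0 ->
  (\rank (map_mx intr A : 'M[F]_(p, q)) <= \rank (map_mx intr A : 'M[k]_(p, q)))%N.
Proof.
move=> /pcharf0P k0; have [f [g]] := exists_minor (map_mx intr A : 'M[F]_(p, q)).
rewrite -map_mxsub det_map_mx => d0; apply: (@minor_rank _ _ _ _ _ f g).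
rewrite -map_mxsub det_map_mx; apply: contraNneq d0.
by case: (\det _) => n /eqP; rewrite /= /intmul ?oppr_eq0 k0 => // /eqP->.
Qed.

Section Deformation.
Variables (k : fieldType) (p q : nat).
Hypothesis k0 : [pchar k] =i pred0.

(* A nonvanishing minor of [A] is the value at 0 of a polynomial in [t], which
   is nonzero at some positive integer [t]. *)
Lemma rank_deform (A B : 'M[k]_(p, q)) :
  exists2 t : k, t != 0 & (\rank A <= \rank (A + t *: B)%R)%N.
Proof.
have [f [g d0]] := exists_minor A.
pose P := \det (map_mx polyC (mxsub f g A) + 'X *: map_mx polyC (mxsub f g B)).
have PE t : P.[t] = \det (mxsub f g (A + t *: B)).
  rewrite -/(horner_eval t P) -det_map_mx; congr (\det _); apply/matrixP => i j.
  by rewrite !mxE /= /horner_eval hornerD hornerM hornerX !hornerC.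
have P0 : P != 0.
  have := PE 0; rewrite scale0r addr0; apply: contraPneq => ->.
  by rewrite horner0 => /esym/eqP; apply/negP.
suff [t t0 Pt] : exists2 t : k, t != 0 & P.[t] != 0.
  by exists t => //; apply: (@minor_rank _ _ _ _ _ f g); rewrite -PE.
(* These are [size P] distinct nonzero elements, more than the degree of [P], so they cannot all be
   roots. *)
pose s : seq k := [seq n.+1%:R | n <- iota 0 (size P)].
have us : uniq s.
  rewrite map_inj_uniq ?iota_uniq // => x y /eqP; rewrite -subr_eq0.
  move/pcharf0P: k0 => n0; wlog xy : x y / (x <= y)%N => [wl|].
    by case/orP: (leq_total x y) => /wl; [|rewrite -oppr_eq0 opprB => h /h].
  by rewrite -oppr_eq0 opprB -natrB // n0 subSS subn_eq0 => yx; apply/eqP; rewrite eqn_leq xy.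
have /allPn[t] : ~~ all (root P) s.
  by apply: contraTN isT => /(max_poly_roots P0)/(_ us); rewrite size_map size_iota ltnn.
case/mapP => n _ ->; exists n.+1%:R => //.
by move/pcharf0P: k0 => ->.
Qed.
End Deformation.

(** * Maximality of the rank for the sum of the variables *)

Section Unit.
Variables (N : nat) (adj : rel 'I_N) (k : fieldType).
Hypothesis k0 : [pchar k] =i pred0.
Implicit Types a : 'I_N -> k.

(** The entry [a i] at [face t = i |: face s] equals [pi (face t) / pi (face s)], so rescaling rows
    and columns reduces to the all-ones form. *)
Lemma rank_lef_mx_unit a j : (forall i, a i != 0) ->
  (\rank (lef_mx adj a j) <= \rank (lef_mx adj (fun _ => 1%R : k) j))%N.
Proof.
move=> a0; pose pi (S : {set 'I_N}) := \prod_(i in S) a i.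
have -> : lef_mx adj a j = diag_mx (\row_(s < #|faces adj j|) (pi (face s))^-1)
    *m lef_mx adj (fun _ => 1) j *m diag_mx (\row_(t < #|faces adj j.+1|) pi (face t)).
  rewrite mul_diag_mx mul_mx_diag; apply/matrixP => s t; rewrite !mxE.
  rewrite big_distrr big_distrl /=; apply: eq_bigr => i /andP[it /eqP <-].
  rewrite mulr1 [pi (face t)](big_setD1 i) //= mulrCA mulVf ?mulr1 //.
  by apply/prodf_neq0.
exact: leq_trans (mxrankM_maxl _ _) (mxrankM_maxr _ _).
Qed.

Lemma rank_lef_mx_le a j :
  (\rank (lef_mx adj a j) <= \rank (lef_mx adj (fun _ => 1%R : k) j))%N.
Proof.
(* With [b] the indicator of the zeros of [a], all coefficients of [a + t b] are nonzero as soon as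
   [t] is. *)
pose b i : k := (a i == 0)%:R.
have [t t0] := rank_deform k0 (lef_mx adj a j) (lef_mx adj b j).
have -> : lef_mx adj a j + t *: lef_mx adj b j = lef_mx adj (fun i => a i + t * b i) j.
  by apply/matrixP => s u; rewrite !mxE big_distrr -big_split.
move=> /leq_trans; apply; apply: rank_lef_mx_unit => i; rewrite /b.
by case: (eqVneq (a i) 0) => [->|]; rewrite ?add0r ?mulr1 ?mulr0 ?addr0.
Qed.

Lemma has_WLP_rank :
  has_WLP k N adj <-> forall j, let r := \rank (lef_mx adj (fun _ => 1%R : k) j) in
    (r == #|faces adj j|) || (r == #|faces adj j.+1|).
Proof.
rewrite has_WLP_mx; split=> [[a wlp] j /=|]; last by exists (fun _ => 1).
have le := rank_lef_mx_le a j; case/orP: (wlp j) => /eqP rE; rewrite rE in le.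
  by rewrite eqn_leq le rank_leq_row.
by rewrite [X in _ || X]eqn_leq le rank_leq_col orbT.
Qed.
End Unit.

(* Each row [x.1] is outside the subspace of [A] vanishing at coordinate [x.2],
   which contains all the later rows. *)
Lemma triangular_rank (F : fieldType) m n (A : 'M[F]_(m, n)) (ws : seq ('rV[F]_n * 'I_n)) :
  all (fun x : 'rV[F]_n * 'I_n => (x.1 <= A)%MS && (x.1 0 x.2 != 0)) ws ->
  pairwise (fun x y : 'rV[F]_n * 'I_n => y.1 0 x.2 == 0) ws -> (size ws <= \rank A)%N.
Proof.
elim: ws m A => [|[w i] ws IH] m A //= /andP[/andP[wA wi] allA] /andP[ws0 pws].
pose K := kermx (delta_mx i 0 : 'M[F]_(n, 1)).
have inK (v : 'rV_n) : (v <= K)%MS = (v 0 i == 0).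
  rewrite sub_kermx -colE; apply/eqP/eqP => [/matrixP/(_ 0 0)|v0]; first by rewrite !mxE.
  by apply/matrixP => r c; rewrite !mxE ord1.
have : (size ws <= \rank (A :&: K))%N.
  apply: IH => //; apply/allP => -[v l] vws /=; rewrite sub_capmx inK.
  have /andP[-> ->] := allP allA _ vws.
  by rewrite (allP ws0 _ vws).
move=> /leq_ltn_trans; apply; apply: rank_ltmx; rewrite ltmxErank capmxSl /=.
rewrite ltn_neqAle mxrankS ?capmxSl // andbT; apply: contra wi => eqr.
rewrite -inK; apply: submx_trans wA _.
by apply: submx_trans (capmxSr A K); rewrite -(mxrank_leqif_sup (capmxSl A K)).
Qed.

(** * Cokernel elements from pairings *)

Section Separated.
Variables (V : eqType) (adj : rel V).

Definition apart (x y : V) := [&& x != y, ~~ adj x y & ~~ adj y x].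

(** Only vertices of different pairs are compared: a monomial of the product takes one vertex from
    each pair, so the two vertices of a pair may be adjacent. *)
Definition separated (p q : V * V) :=
  [&& apart p.1 q.1, apart p.1 q.2, apart p.2 q.1 & apart p.2 q.2].

Definition hits_once (ps : seq (V * V)) (T : pred V) :=
  all (fun p => (p.1 \in T) (+) (p.2 \in T)) ps.

Lemma apartC x y : apart x y = apart y x.
Proof. by rewrite /apart eq_sym [X in _ && X]andbC. Qed.

Lemma separatedC p q : separated p q = separated q p.
Proof.
rewrite /separated !(apartC q.1) !(apartC q.2).
by case: (apart p.1 q.1); case: (apart p.2 q.1); case: (apart p.1 q.2).
Qed.

Lemma pairwise_separated ps p q :
  pairwise separated ps -> p \in ps -> q \in ps -> (p == q) || separated p q.
Proof.
elim: ps => // r ps IH /= /andP[rps sep]; rewrite !inE.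
case/predU1P => [->|pps]; case/predU1P => [->|qps]; first by rewrite eqxx.
- by rewrite (allP rps) ?orbT.
- by rewrite separatedC (allP rps) ?orbT.
exact: IH.
Qed.
End Separated.

Section Pairing.
Variables (N : nat) (adj : rel 'I_N) (k : fieldType).
Implicit Types (ps : seq ('I_N * 'I_N)) (S T : {set 'I_N}).

(** For disjoint pairs and [#|T| = size ps], this is the coefficient of the monomial of [T] in the
    product of the differences [x_a - x_b]. *)
Definition pairing_coef ps T : k := \prod_(p <- ps) ((p.1 \in T)%:R - (p.2 \in T)%:R).

Lemma pairing_coef_neq0 ps T :
  (pairing_coef ps T != 0) = hits_once ps (mem T).
Proof.
rewrite /pairing_coef; elim: ps => [|p ps IH]; first by rewrite big_nil oner_eq0.
rewrite big_cons mulf_eq0 negb_or IH /= !inE; congr (_ && _).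
by case: (p.1 \in T); case: (p.2 \in T); rewrite ?subrr ?subr0 ?sub0r ?oppr_eq0 ?oner_eq0 ?eqxx.
Qed.

(** Separated pairs are disjoint, so [S] meets them in different elements. *)
Lemma meet_size ps S : pairwise (separated adj) ps ->
  all (fun p => (p.1 \in S) || (p.2 \in S)) ps -> (size ps <= #|S|)%N.
Proof.
elim: ps S => //= p ps IH S /andP[psep sep] /andP[pS allS].
have [x xS xp] : exists2 x, x \in S & (x == p.1) || (x == p.2).
  by case/orP: pS => xS; [exists p.1|exists p.2]; rewrite ?eqxx ?orbT.
rewrite (cardsD1 x) xS ltnS; apply: IH => //; apply/allP => q qps.
have /and4P[/and3P[n1 _ _] /and3P[n2 _ _] /and3P[n3 _ _] /and3P[n4 _ _]] := allP psep _ qps.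
rewrite !inE; have := allP allS _ qps.
by case/orP: xp => /eqP->; rewrite !(eq_sym q.1) !(eq_sym q.2) ?n1 ?n2 ?n3 ?n4.
Qed.

Lemma pairing_face ps T : pairwise (separated adj) ps -> #|T| = size ps ->
  pairing_coef ps T != 0 -> T \in faces adj (size ps).
Proof.
move=> sep cT; rewrite pairing_coef_neq0 => /allP trT; rewrite inE cT eqxx andbT.
(* A vertex of [T] outside all pairs would leave only [size ps - 1] vertices to meet [size ps]
   disjoint pairs. *)
have inU i : i \in T -> exists2 p, p \in ps & (i == p.1) || (i == p.2).
  move=> iT; case: (boolP (has (fun p => (i == p.1) || (i == p.2)) ps)) => [/hasP //|].
  move=> /hasPn niU; have : (size ps <= #|T :\ i|)%N.
    apply: meet_size => //; apply/allP => p pps; have := trT p pps; have := niU p pps.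
    rewrite !inE negb_or !(eq_sym i) => /andP[-> ->] /=.
    by case: (p.1 \in T).
  by rewrite -cT (cardsD1 i) iT ltnn.
apply/forall_inP => i iT; apply/forall_inP => j jT; apply/implyP => ij.
have [[p pps ip] [q qps jq]] := (inU i iT, inU j jT).
case/orP: (pairwise_separated sep pps qps) => [/eqP pq|].
  move: iT jT (trT p pps); rewrite -pq in jq; clear ij.
  by case/orP: ip => /eqP->; case/orP: jq => /eqP->; rewrite ?eqxx // !inE => -> ->.
case/and4P=> /and3P[_ n1 _] /and3P[_ n2 _] /and3P[_ n3 _] /and3P[_ n4 _].
by case/orP: ip ij => /eqP->; case/orP: jq => /eqP->;
  rewrite ?(negPf n1) ?(negPf n2) ?(negPf n3) ?(negPf n4).
Qed.

(** [S] is too small to meet every pair. If it misses [(a, b)], only [v = a] and [v = b] contribute,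
    with opposite signs. *)
Lemma pairing_sum ps S : pairwise (separated adj) ps -> (#|S| < size ps)%N ->
  \sum_(v | v \notin S) pairing_coef ps (v |: S) = 0.
Proof.
move=> sep ltS.
have : ~~ all (fun p => (p.1 \in S) || (p.2 \in S)) ps.
  by apply: contraL ltS => /(meet_size sep); rewrite -leqNgt.
case/allPn => -[a b] pps; rewrite negb_or /= => /andP[p1 p2].
case/splitPr: pps sep {ltS} => ps1 ps2; rewrite pairwise_cat /= => /and3P[sep1 _ /andP[sep2 _]].
pose r := pairing_coef (ps1 ++ ps2) S.
have coefE v : pairing_coef (ps1 ++ (a, b) :: ps2) (v |: S)
    = ((a == v)%:R - (b == v)%:R) * pairing_coef (ps1 ++ ps2) (v |: S).
  rewrite /pairing_coef !big_cat big_cons /= mulrCA !inE (negPf p1) (negPf p2) !orbF.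
  by [].
have rE v : (v == a) || (v == b) -> pairing_coef (ps1 ++ ps2) (v |: S) = r.
  move=> vab; apply: eq_big_seq => q; rewrite mem_cat => qps.
  have /and4P[/and3P[n1 _ _] /and3P[n2 _ _] /and3P[n3 _ _] /and3P[n4 _ _]] :
      separated adj (a, b) q.
    case/orP: qps => qps; last exact: (allP sep2).
    by rewrite separatedC; apply: (allrelP sep1) => //; rewrite mem_head.
  rewrite !inE; case/orP: vab => /eqP->.
    by rewrite !(eq_sym _ a) (negPf n1) (negPf n2).
  by rewrite !(eq_sym _ b) (negPf n3) (negPf n4).
under eq_bigr => v _ do rewrite coefE.
have [ab|ab] := eqVneq a b; first by rewrite big1 // => v _; rewrite ab subrr mul0r.
rewrite (bigD1 a) //= (bigD1 b) /=; last by rewrite p2 eq_sym.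
rewrite !rE ?eqxx ?orbT // (negPf ab) eq_sym (negPf ab) subr0 sub0r mulN1r mul1r.
rewrite big1 ?addr0 ?subrr // => v /andP[/andP[_ va] vb].
by rewrite eq_sym (negPf va) eq_sym (negPf vb) subrr mul0r.
Qed.

Definition pairing_row ps d : 'rV[k]_#|faces adj d| := \row_t pairing_coef ps (face t).

Lemma pairing_row_ker ps d : pairwise (separated adj) ps -> size ps = d.+1 ->
  (pairing_row ps d.+1 <= kermx (lef_mx adj (fun _ => 1 : k) d)^T)%MS.
Proof.
move=> sep szps; apply/sub_kermxP/rowP => s; rewrite !mxE.
have [_ cS] := faceP s.
rewrite -[RHS](pairing_sum (S := face s) sep) ?szps ?cS //.
under eq_bigr => t _ do rewrite !mxE big_distrr /= big_mkcond /=.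
rewrite exchange_big [RHS]big_mkcond; apply: eq_bigr => i _ /=.
have [iS|niS] /= := boolP (i \in face s).
  rewrite big1 // => t _; case: ifP => // /andP[_ /eqP TS].
  by move: iS; rewrite -TS !inE eqxx.
have TE (t : 'I_#|faces adj d.+1|) :
    (i \in face t) && (face t :\ i == face s) = (face t == i |: face s).
  apply/andP/eqP => [[it /eqP <-]|->]; first by rewrite setD1K.
  by rewrite setU1K // !inE eqxx.
under eq_bigr => t _ do rewrite TE mulr1.
rewrite -big_mkcond /=.
have [/face_surj[t0 t0E]|nface] := boolP (i |: face s \in faces adj d.+1).
  rewrite t0E (bigD1 t0) //= big1 ?addr0 // => t /andP[/eqP/face_inj->].
  by rewrite eqxx.
(* Sets that are not faces have coefficient 0, so the sum over all vertices in [pairing_sum] agrees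
   with the sum over faces in the matrix product. *)
have -> : pairing_coef ps (i |: face s) = 0.
  apply/eqP; apply: contraNT nface => /(pairing_face sep).
  by rewrite szps; apply; rewrite cardsU1 niS cS.
by rewrite big1 // => t /eqP tE; rewrite -tE enum_valP in nface.
Qed.

End Pairing.

(** The second and fourth clauses make the first vertices a monomial of degree [d] occurring in the
    product; it serves as leading monomial in [unitriangular]. *)
Definition pairing (V : eqType) (adj : rel V) (d : nat) (ps : seq (V * V)) :=
  [&& size ps == d, uniq (unzip1 ps), pairwise (separated adj) ps
    & hits_once ps (mem (unzip1 ps))].

(* The monomial of the first vertices of [ps] does not occur in the products of
   the pairings that follow [ps] in [L]. *)
Definition unitriangular (V : eqType) (L : seq (seq (V * V))) :=
  pairwise (fun ps qs => ~~ hits_once qs (mem (unzip1 ps))) L.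

(** The products lie in the kernel of the transpose, whose dimension is the corank, and their
    leading monomials make them independent. *)
Lemma pairings_rank (N : nat) (adj : rel 'I_N) (k : fieldType) d L :
  all (pairing adj d.+1) L -> unitriangular L ->
  (\rank (lef_mx adj (fun _ => 1%R : k) d) + size L <= #|faces adj d.+1|)%N.
Proof.
move=> pL triL; set M := lef_mx _ _ _.
suff : (size L <= \rank (kermx M^T))%N.
  rewrite mxrank_ker mxrank_tr => /(leq_add (leqnn (\rank M))) /leq_trans; apply.
  by rewrite subnKC // rank_leq_col.
(* The empty list is trivial; otherwise [ps0] supplies the default face that [pos] requires. *)
case: L pL triL => // ps0 L0; set L := ps0 :: L0 => pL triL.
have leadP ps : ps \in L -> [set i in unzip1 ps] \in faces adj d.+1.
  move=> psL; have /and4P[/eqP sz un sep tr] := allP pL _ psL.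
  rewrite -sz (@pairing_face _ _ k) //; last first.
    rewrite pairing_coef_neq0; move: tr; rewrite /hits_once.
    by apply: etrans; apply: eq_all => p /=; rewrite !inE.
  by rewrite cardsE (card_uniqP un) size_map.
pose pos (ps : seq ('I_N * 'I_N)) : 'I_#|faces adj d.+1| :=
  enum_rank_in (leadP ps0 (mem_head _ _)) [set i in unzip1 ps].
have coefE ps qs : qs \in L -> (pairing_row adj k ps d.+1 0 (pos qs) != 0)
    = hits_once ps (mem (unzip1 qs)).
  move=> qsL; rewrite mxE /face enum_rankK_in ?leadP // pairing_coef_neq0.
  by apply: eq_all => p /=; rewrite !inE.
rewrite -(size_map (fun ps => (pairing_row adj k ps d.+1, pos ps))).
apply: triangular_rank.
  rewrite all_map; apply/allP => ps psL /=; have /and4P[/eqP sz _ sep tr] := allP pL _ psL.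
  by rewrite pairing_row_ker // coefE.
rewrite pairwise_map; apply: sub_in_pairwise (allss L) triL => ps qs psL qsL /=.
by rewrite -[_ == 0]negbK coefE.
Qed.

(** The rank is at most the target dimension minus [size L], hence below both dimensions. Vertices
    are natural numbers here so that the conditions on [L] can be computed. *)
Lemma pairings_not_WLP (N : nat) (adj : rel nat) (k : fieldType) d L :
  [pchar k] =i pred0 ->
  all (all (fun p => (p.1 < N)%N && (p.2 < N)%N)) L ->
  all (pairing adj d.+1) L -> unitriangular L -> (0 < size L)%N ->
  (#|faces (relpre (val : 'I_N -> nat) adj) d.+1|
     < #|faces (relpre (val : 'I_N -> nat) adj) d| + size L)%N ->
  ~ has_WLP k N (relpre (val : 'I_N -> nat) adj).
Proof.
move=> k0 bL pL triL L0 ltL /(has_WLP_rank _ k0) /(_ d) /=.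
pose v2 (p : 'I_N * 'I_N) := (val p.1, val p.2).
have [L' LE] : exists L' : seq (seq ('I_N * 'I_N)), L = map (map v2) L'.
  elim: L bL {pL triL L0 ltL} => [_|ps L IH /= /andP[bps /IH[L' ->]]]; first by exists [::].
  suff [ps' ->] : exists ps', ps = map v2 ps' by exists (ps' :: L').
  elim: ps bps => [_|[a b] ps IHp /= /andP[/andP[aN bN] /IHp[ps' ->]]]; first by exists [::].
  by exists ((Ordinal aN, Ordinal bN) :: ps').
have unE ps : unzip1 (map v2 ps) = map val (unzip1 ps) by rewrite /unzip1 -!map_comp.
have trE ps qs : hits_once (map v2 ps) (mem (unzip1 (map v2 qs)))
    = hits_once ps (mem (unzip1 qs)).
  by rewrite /hits_once all_map; apply: eq_all => p /=; rewrite !unE !(mem_map val_inj).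
set adj' := relpre _ adj in ltL *.
have := @pairings_rank N adj' k d L' _ _.
have -> : all (pairing adj' d.+1) L'.
  move: pL; rewrite LE all_map; apply: etrans; apply: eq_all => ps /=.
  rewrite /pairing trE size_map unE (map_inj_uniq val_inj) pairwise_map.
  by congr [&& _, _, _ & _]; apply: eq_pairwise.
have -> : unitriangular L'.
  move: triL; rewrite LE /unitriangular pairwise_map; apply: etrans.
  by apply: eq_pairwise => ps qs /=; rewrite trE.
move=> /(_ isT isT) rk; have szE : size L' = size L by rewrite LE size_map.
rewrite szE in rk; case/orP => /eqP rE; rewrite rE in rk.
  by rewrite ltnNge rk in ltL.
by move: rk; rewrite -[X in (_ <= X)%N]addn0 leq_add2l leqNgt L0.
Qed.

(** * Counting the independent sets of a tadpole *)

Local Open Scope nat_scope.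

(** Independence polynomials are given by their coefficient functions; [shift] is multiplication by
    the variable [t], and [fib] solves [F_{n+2} = F_{n+1} + t F_n]. *)
Definition shift (f : nat -> nat) j := if j is i.+1 then f i else 0.

Fixpoint fib (f g : nat -> nat) n : nat -> nat :=
  if n is n'.+1 then fib g (fun j => g j + shift f j) n' else f.

Lemma fibS f g n j : fib f g n.+2 j = fib f g n.+1 j + shift (fib f g n) j.
Proof. by elim: n f g => [|n IH] f g //; rewrite -IH. Qed.

Lemma eq_fib F f g : F 0 =1 f -> F 1 =1 g ->
  (forall n j, F n.+2 j = F n.+1 j + shift (F n) j) -> forall n, F n =1 fib f g n.
Proof.
move=> F0 F1 FS n; suff [] : F n =1 fib f g n /\ F n.+1 =1 fib f g n.+1 by [].
elim: n => [|n [IH0 IH1]]; first by split.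
by split=> // j; rewrite FS fibS IH1; congr (_ + _); case: j => //=.
Qed.

Definition bits N (S : {set 'I_N}) : bitseq := [seq i \in S | i <- enum 'I_N].

Lemma size_bits N (S : {set 'I_N}) : size (bits S) = N.
Proof. by rewrite size_map size_enum_ord. Qed.

Lemma nth_bits N (S : {set 'I_N}) (i : 'I_N) : nth false (bits S) i = (i \in S).
Proof. by rewrite (nth_map i) ?nth_ord_enum // size_enum_ord. Qed.

Lemma bits_inj N : injective (@bits N).
Proof. by move=> S T e; apply/setP => i; rewrite -!nth_bits e. Qed.

Lemma bits_nth N b : size b = N -> b = bits [set i : 'I_N | nth false b i].
Proof.
move=> sb; apply: (@eq_from_nth _ false); rewrite ?size_bits // sb => i iN.
by have := nth_bits [set i : 'I_N | nth false b i] (Ordinal iN); rewrite inE => /= ->.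
Qed.

Lemma count_bits N (S : {set 'I_N}) : count id (bits S) = #|S|.
Proof. by rewrite count_map -sum1_count -sum1_card big_enum_cond. Qed.

Fixpoint words n : seq bitseq :=
  if n is n'.+1 then map (cons true) (words n') ++ map (cons false) (words n')
  else [:: [::]].

Lemma mem_words n b : (b \in words n) = (size b == n).
Proof.
elim: n b => [|n IH] [|x b] //=; rewrite mem_cat.
  by apply/negP => /orP[] /mapP[].
have mem_cons y z : (y :: b \in map (cons z) (words n)) = (y == z) && (size b == n).
  apply/mapP/andP => [[c + [-> ->]]|[/eqP-> sb]]; first by rewrite IH eqxx.
  by exists b; rewrite ?IH.
by rewrite !mem_cons; case: x; rewrite ?orbF eqSS.
Qed.

Lemma uniq_words n : uniq (words n).
Proof.
elim: n => //= n IH; rewrite cat_uniq !map_inj_uniq ?IH ?andbT => [|x y []|x y []] //.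
by apply/hasPn => _ /mapP[b _ ->]; apply/mapP => -[].
Qed.

Lemma card_words N (P : pred bitseq) : #|[set S : {set 'I_N} | P (bits S)]| = count P (words N).
Proof.
have pe : perm_eq (map (@bits N) (enum {set 'I_N})) (words N).
  apply: uniq_perm; rewrite ?uniq_words ?(map_inj_uniq (@bits_inj N)) ?enum_uniq // => b.
  rewrite mem_words; apply/mapP/eqP => [[S _ ->]|/bits_nth->]; first exact: size_bits.
  by eexists; [exact: mem_enum|].
rewrite -(permP pe) count_map -sum1_count -sum1_card big_enum_cond /=.
by apply: eq_bigl => S; rewrite inE.
Qed.

Lemma count_wordsS n (P : pred bitseq) : count P (words n.+1) =
  count (fun b => P (true :: b)) (words n) + count (fun b => P (false :: b)) (words n).
Proof. by rewrite /= count_cat !count_map. Qed.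

Definition nand (x y : bool) := ~~ (x && y).

(* A tadpole is the path on all its vertices, plus the edge closing the cycle. *)
Definition tadpole_bits m (b : bitseq) :=
  sorted nand b && nand (nth false b 0) (nth false b m.-1).

Definition tadpole_adj m : rel nat := fun a b => tadpole_edge m 3 a b || tadpole_edge m 3 b a.

Lemma tadpoleE m : tadpole m 3 = relpre (val : 'I_(m + 3) -> nat) (tadpole_adj m).
Proof. by []. Qed.

Lemma indep_bits m (S : {set 'I_(m + 3)}) : 2 < m ->
  indep (tadpole m 3) S = tadpole_bits m (bits S).
Proof.
move=> m2; apply/idP/andP => [/forall_inP iS|[/(sortedP false) sb cyc]].
  have iS' a b (aN : a < m + 3) (bN : b < m + 3) : tadpole_adj m a b -> a != b ->
      nand (nth false (bits S) a) (nth false (bits S) b).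
    move=> ab nab; apply/andP => -[].
    rewrite (nth_bits S (Ordinal aN)) (nth_bits S (Ordinal bN)) => aS bS.
    have /forall_inP/(_ _ bS)/implyP/(_ ab) := iS _ aS.
    by rewrite -val_eqE /= (negPf nab).
  split; last by apply: iS'; rewrite /tadpole_adj /tadpole_edge; lia.
  apply/(sortedP false) => a; rewrite size_bits => aN.
  by apply: iS' => //; rewrite /tadpole_adj /tadpole_edge; lia.
apply/forall_inP => i iS; apply/forall_inP => j jS; apply/implyP.
have step (u v : 'I_(m + 3)) : u \in S -> v \in S -> u.+1 = v -> False.
  move=> uS vS uv; have := sb u; rewrite size_bits uv ltn_ord => /(_ isT).
  by rewrite !nth_bits uS vS.
have close (u v : 'I_(m + 3)) : u \in S -> v \in S -> u = m.-1 :> nat -> v = 0 :> nat -> False.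
  by move=> uS vS uE vE; move: cyc; rewrite -uE -[X in nth _ _ X]vE !nth_bits uS vS.
rewrite /tadpole /tadpole_edge => ij; exfalso.
have := step i j iS jS; have := step j i jS iS; have := close i j iS jS.
have := close j i jS iS; move: ij => /=; move: (nat_of_ord i) (nat_of_ord j) => a b.
lia.
Qed.

(** Here [b] is a suffix of the word of a set: [prev] is the bit just before it, [first] the bit of
    vertex 0, and [k] the index in [b] of the vertex closing the cycle, followed by three path
    vertices. *)
Definition tadpole_tail k (prev first : bool) j (b : bitseq) :=
  [&& path nand prev b, nand first (nth false b k) & count id b == j].

Lemma count_tailSt k first j :
  count (tadpole_tail k.+1 true first j) (words (k.+1 + 4))
    = count (tadpole_tail k false first j) (words (k + 4)).
Proof.
rewrite addSn count_wordsS (@eq_count _ _ pred0) ?count_pred0 //.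
Qed.

Lemma count_tailSf k first j :
  count (tadpole_tail k.+1 false first j) (words (k.+1 + 4))
    = shift (fun i => count (tadpole_tail k true first i) (words (k + 4))) j
      + count (tadpole_tail k false first j) (words (k + 4)).
Proof.
rewrite addSn count_wordsS; congr (_ + _); case: j => [|j] /=.
  by rewrite (@eq_count _ _ pred0) ?count_pred0 // => b; rewrite /tadpole_tail /= !andbF.
by apply: eq_count.
Qed.

(* The recurrence for [m >= 3] continues down to [m = 1, 2], with the independence
   polynomials of the paths on 3 and 5 vertices. *)
Definition tadpole_count m := fib (nth 0 [:: 1; 3; 1]) (nth 0 [:: 1; 5; 6; 1]) m.-1.

Lemma card_faces_tadpole m j : 2 < m -> #|faces (tadpole m 3) j| = tadpole_count m j.
Proof.
move=> m2; transitivity (count (fun b => tadpole_bits m b && (count id b == j)) (words (m + 3))).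
  rewrite -card_words; congr #|pred_of_set _|; apply/setP => S.
  by rewrite !inE indep_bits // count_bits.
pose W first k j := count (tadpole_tail k false first j) (words (k + 4)).
have WS first k i : W first k.+2 i = W first k.+1 i + shift (W first k) i.
  rewrite /W count_tailSf addnC; congr (_ + _); case: i => //= i.
  exact: count_tailSt.
(* Here [n = m - 3], and the terms split on the bit of vertex 0. If it is set, the next bit must be
   [false], so the suffix is one shorter. *)
pose F n i := W false n.+1 i + shift (W true n) i.
have FS n i : F n.+2 i = F n.+1 i + shift (F n) i.
  by rewrite /F !WS; case: i => [|i] //=; rewrite WS; lia.
pose f3 := nth 0 [:: 1; 6; 9; 2]; pose f4 := nth 0 [:: 1; 7; 14; 8; 1].
have F0 : F 0 =1 f3 by do 7! [case=> //].
have F1 : F 1 =1 f4 by do 7! [case=> //].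
case: m m2 => [|[|[|n]]] // _; rewrite -[tadpole_count _ _]/(fib _ _ n.+2 j).
transitivity (F n j).
  rewrite (_ : n.+3 + 3 = (n.+1 + 4).+1); last by lia.
  rewrite count_wordsS addnC /F /W; congr (_ + _).
    by apply: eq_count => b; rewrite /tadpole_bits /tadpole_tail /= -andbA.
  case: j => [|j] /=.
    by rewrite (@eq_count _ _ pred0) ?count_pred0 // => b; rewrite /= andbF.
  rewrite -count_tailSt; apply: eq_count => b.
  by rewrite /tadpole_bits /tadpole_tail /= -andbA.
rewrite (eq_fib F0 F1 FS); apply/esym.
pose G i := fib (nth 0 [:: 1; 3; 1]) (nth 0 [:: 1; 5; 6; 1]) i.+2.
apply: (eq_fib (F := G)) => [||i l]; last exact: fibS.
  by rewrite /G; do 5! [case=> //].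
by rewrite /G; do 6! [case=> //].
Qed.

(** * Evaluation of the counts in binary arithmetic *)

Definition valN (s : seq BinNums.N) j : nat := BinNat.N.to_nat (nth BinNums.N0 s j).

Fixpoint addN (s t : seq BinNums.N) :=
  match s, t with
  | [::], _ => t
  | _, [::] => s
  | x :: s', y :: t' => BinNat.N.add x y :: addN s' t'
  end.

Fixpoint fibN f g n :=
  if n is n'.+1 then fibN g (addN g (BinNums.N0 :: f)) n' else f.

Lemma valN_add s t j : valN (addN s t) j = valN s j + valN t j.
Proof.
elim: s t j => [|x s IH] [|y t] [|j] //=; rewrite /valN ?nth_nil ?addn0 //=.
- exact: Nnat.N2Nat.inj_add.
exact: IH.
Qed.

Lemma fib_ext f f' g g' n : f =1 f' -> g =1 g' -> fib f g n =1 fib f' g' n.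
Proof.
move=> ff gg; by apply: (eq_fib (F := fib f g)) => // i j; exact: fibS.
Qed.

Lemma fibNE f g n j : valN (fibN f g n) j = fib (valN f) (valN g) n j.
Proof.
elim: n f g => //= n IH f g; rewrite IH; apply: fib_ext => // i.
by rewrite valN_add; case: i.
Qed.

Definition tadpole_countN m : seq BinNums.N := 
  fibN (map BinNat.N.of_nat [:: 1; 3; 1]) (map BinNat.N.of_nat [:: 1; 5; 6; 1]) m.-1.

Lemma tadpole_countNE m j : tadpole_count m j = valN (tadpole_countN m) j.
Proof.
rewrite fibNE; apply: fib_ext => i; rewrite /valN.
  by do 4! [case: i => // i].
by do 5! [case: i => // i].
Qed.

Definition count_leN m j c :=
  BinNat.N.leb (nth BinNums.N0 (tadpole_countN m) j.+1)
    (BinNat.N.add (nth BinNums.N0 (tadpole_countN m) j) c).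

Lemma count_leNP m j c : count_leN m j c ->
  tadpole_count m j.+1 <= tadpole_count m j + BinNat.N.to_nat c.
Proof. by move=> /BinNat.N.leb_le; rewrite !tadpole_countNE /valN; lia. Qed.

(** These are the [m] from 3 to 44 outside the list of the theorem, except 13, 17 and 20. *)
Lemma tadpole_count_small m : m \in [:: 9; 12; 15; 16; 18; 19] ++ iota 21 24 ->
  tadpole_count m (m %/ 3).+1 <= tadpole_count m (m %/ 3).
Proof.
move=> mS; rewrite -[leqRHS]addn0; apply: (@count_leNP _ _ BinNums.N0).
by apply: (allP (_ : all (fun m => count_leN m (m %/ 3) BinNums.N0) _)) mS; vm_compute.
Qed.

(** For [n >= 1] this counts the independent [j]-sets of the path on [n - 1] vertices. *)
Definition psi n j := 'C(n - j, j).

Lemma psiS n j : psi n.+2 j = psi n.+1 j + shift (psi n) j.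
Proof.
case: j => [|j]; rewrite /psi /= ?bin0 // !subSS.
have [jn|nj] := leqP j n; first by rewrite subSn // binS.
rewrite (eqP (ltnW nj : n - j == 0)) (eqP (_ : n.+1 - j == 0)) ?subn_eq0 //.
by case: j nj.
Qed.

(** With [Psi_n] the polynomial of [psi n], this is [(1 + 5t + 6t^2 + t^3) Psi_{n+1} + t (1 + 3t +
    t^2) Psi_n], the solution of the recurrence with the initial values of [tadpole_count]. *)
Definition psi_comb n j := psi n.+1 j + 5 * shift (psi n.+1) j
  + 6 * shift (shift (psi n.+1)) j + shift (shift (shift (psi n.+1))) j
  + shift (psi n) j + 3 * shift (shift (psi n)) j + shift (shift (shift (psi n))) j.

Lemma tadpole_count_psi n j : tadpole_count n.+3 j = psi_comb n j.
Proof.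
have FS i l : psi_comb i.+2 l = psi_comb i.+1 l + shift (psi_comb i) l.
  by rewrite /psi_comb; case: l => [|[|[|[|l]]]]; rewrite /= !psiS /=; lia.
have F0 : psi_comb 0 =1 tadpole_count 3 by do 7! [case=> //].
have F1 : psi_comb 1 =1 tadpole_count 4 by do 7! [case=> //].
rewrite (eq_fib F0 F1 FS); apply: (eq_fib (F := fun i => tadpole_count i.+3)) => // i l.
exact: fibS.
Qed.

(** The two products are the numerator and denominator of the ratio [psi n j.+1 / psi n j]. *)
Lemma psi_le n j : (n - 2 * j) * (n - 2 * j - 1) <= j.+1 * (n - j) -> psi n j.+1 <= psi n j.
Proof.
move=> le; rewrite /psi subnS.
have [lt|] := ltnP (2 * j) n; last by move=> ?; rewrite bin_small //; lia.
have N0 : 0 < n - j by lia.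
rewrite -(@leq_pmul2l (j.+1 * (n - j))) ?muln_gt0 //.
rewrite -{1}(mulnC (n - j)) -mulnA mul_bin_left mulnCA mul_bin_down mulnA.
rewrite leq_mul2r; apply/orP; right; apply: leq_trans le.
by rewrite [leqRHS]mulnC leq_mul //; lia.
Qed.

Lemma tadpole_count_large m : 44 < m ->
  tadpole_count m (m %/ 3).+1 <= tadpole_count m (m %/ 3).
Proof.
move=> m44; set q := m %/ 3.
have [q15 mq] : 15 <= q /\ m <= 3 * q + 2 by rewrite /q; lia.
(* The shifts in [psi_comb] reach down three degrees, hence [q - 3]. At [q = 15], [n = 45],
   [i = 12], the condition of [psi_le] reads 420 <= 429; at [q = 14], [n = 42], [i = 11], it would
   read 380 <= 372, whence the bound 44. *)
have le n i : n <= 3 * q -> q - 3 <= i -> psi n i.+1 <= psi n i.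
  move=> nq qi; apply: psi_le; have [|lt] := leqP n (2 * i); first by rewrite -subn_eq0 => /eqP->.
  have : n - 2 * i <= q + 6 by lia.
  rewrite (_ : n - i = n - 2 * i + i); last by lia.
  by move: (n - 2 * i) => a; nia.
move: q q15 mq le; case: m m44 => [|[|[|n]]] // _ [|[|[|J]]] // q15 mq le.
rewrite !tadpole_count_psi /psi_comb /=.
have n1 : n.+1 <= 3 * J.+3 by lia.
have n0 : n <= 3 * J.+3 by lia.
rewrite !leq_add ?leq_mul2l ?le //; lia.
Qed.

(** * Gaussian elimination modulo 7 *)

(* A sparse vector indexed by bit words; the [true] branch comes first, so the
   leading position is the lexicographically largest one. *)
Inductive tree (A : Type) := Tip | Bin of A & tree A & tree A.
Arguments Tip {A}.

Notation sparse := (tree nat).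

Fixpoint coef (t : sparse) (b : bitseq) : nat :=
  match t, b with
  | Tip, _ => 0
  | Bin c _ _, [::] => c
  | Bin _ l r, x :: b' => coef (if x then l else r) b'
  end.

(** Prunes the branches that cancel, which keeps the vectors sparse during elimination. *)
Definition bin c (l r : sparse) :=
  match c, l, r with 0, Tip, Tip => Tip | _, _, _ => Bin c l r end.

Fixpoint scale f (t : sparse) :=
  if t is Bin c l r then Bin ((f * c) %% 7) (scale f l) (scale f r) else Tip.

Fixpoint axpy f (t u : sparse) :=
  match t, u with
  | Tip, _ => scale f u
  | _, Tip => t
  | Bin c l r, Bin c' l' r' => bin ((c + f * c') %% 7) (axpy f l l') (axpy f r r')
  end.

Fixpoint single (b : bitseq) : sparse :=
  match b with
  | [::] => Bin 1 Tip Tip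
  | true :: b' => Bin 0 (single b') Tip
  | false :: b' => Bin 0 Tip (single b')
  end.

(** The row and the tree of pivots are traversed together, so the pivot stored at the leading
    position is found in the same pass. *)
Fixpoint lead (P : tree (option sparse)) (t : sparse) :
    option (bitseq * nat * option sparse) :=
  if t is Bin c l r then
    let: (q, Pl, Pr) := if P is Bin q Pl Pr then (q, Pl, Pr) else (None, Tip, Tip) in
    match lead Pl l with
    | Some (b, c', q') => Some (true :: b, c', q')
    | None => match lead Pr r with
      | Some (b, c', q') => Some (false :: b, c', q')
      | None => if c is 0 then None else Some ([::], c, q)
      end
    end
  else None.

Fixpoint insert (b : bitseq) (q : sparse) (P : tree (option sparse)) :=
  let: (q0, l, r) := if P is Bin q0 l r then (q0, l, r) else (None, Tip, Tip) in
  match b with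
  | [::] => Bin (Some q) l r
  | true :: b' => Bin q0 (insert b' q l) r
  | false :: b' => Bin q0 l (insert b' q r)
  end.

Definition inv7 c := nth 0 [:: 0; 1; 4; 5; 2; 3; 6] c.

(* [inv7] makes the pivots monic.  A row meets each pivot at most once, so the
   number of rows plus one is enough fuel. *)
Fixpoint reduce fuel (P : tree (option sparse)) (t : sparse) :=
  if fuel is n.+1 then
    match lead P t with
    | None => P
    | Some (b, c, None) => insert b (scale (inv7 c) t) P
    | Some (b, c, Some q) => reduce n P (axpy (7 - c) t q)
    end
  else P.

Fixpoint pivots (P : tree (option sparse)) : seq (bitseq * sparse) :=
  if P is Bin q l r then
    [seq (true :: x.1, x.2) | x <- pivots l] ++ [seq (false :: x.1, x.2) | x <- pivots r]
      ++ (if q is Some t then [:: ([::], t)] else [::])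
  else [::].

Definition gauss n (rows : seq sparse) := pivots (foldl (reduce n) Tip rows).

(** Echelon form is tested on the output of [gauss]; what is proved about the elimination is that it
    stays in the row space. *)
Definition echelon (ps : seq (bitseq * sparse)) :=
  all (fun x => coef x.2 x.1 %% 7 != 0) ps &&
  pairwise (fun x y => coef y.2 x.1 == 0) ps.

Definition face_word m j (b : bitseq) :=
  [&& size b == m + 3, tadpole_bits m b & count id b == j].

Fixpoint nand_words n (prev : bool) j : seq bitseq :=
  if n is n'.+1 then
    map (cons false) (nand_words n' false j)
      ++ (if j is j'.+1 then if prev then [::] else map (cons true) (nand_words n' true j') else [::])
  else if j is 0 then [:: [::]] else [::].

Definition face_words m j := [seq b <- nand_words (m + 3) false j | face_word m j b].

Definition sum_single (bs : seq bitseq) := foldr (fun b t => axpy 1 t (single b)) Tip bs.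

Definition mul_row m (b : bitseq) :=
  sum_single [seq b' <- [seq set_nth false b i true | i <- iota 0 (m + 3) & ~~ nth false b i]
             | tadpole_bits m b'].

(** A row of the transpose: the sum of the partial derivatives of a monomial. Subsets of independent
    sets are independent, so nothing is filtered out, in contrast to [mul_row]. *)
Definition der_row m (b : bitseq) :=
  sum_single [seq set_nth false b i false | i <- iota 0 (m + 3) & nth false b i].

Definition check_gauss m j rows n :=
  let ps := gauss n.+1 rows in
  [&& echelon ps, all (fun x => face_word m j x.1) ps & size ps == n].

(* The modulus 7 is the smallest prime that works: for [m = 14] the rank from
   degree 4 to degree 5 drops modulo 5. *)
Definition inj_check m j :=
  check_gauss m j.+1 (map (mul_row m) (face_words m j)) (tadpole_count m j).

Definition surj_check m j :=
  check_gauss m j (map (der_row m) (face_words m j.+1)) (tadpole_count m j.+1).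

(** * Soundness of the elimination *)

Lemma coef_bin c l r b : coef (bin c l r) b = coef (Bin c l r) b.
Proof. by case: c l r b => [|c] [|? ? ?] [|? ? ?] [|[] b]. Qed.

Lemma coef_scale f t b : coef (scale f t) b = f * coef t b %[mod 7].
Proof.
elim: t b => [|c l IHl r IHr] [|x b]; rewrite ?muln0 //= ?modn_mod //.
by case: x.
Qed.

Lemma coef_axpy f t u b : coef (axpy f t u) b = coef t b + f * coef u b %[mod 7].
Proof.
elim: t u b => [|c l IHl r IHr] [|c' l' r'] b; rewrite ?muln0 ?addn0 //.
  by rewrite add0n -[axpy f Tip _]/(scale f _) coef_scale.
by rewrite /= coef_bin; case: b => [|[] b] /=; rewrite ?modn_mod.
Qed.

Lemma coef_single b b' : coef (single b) b' = (b' == b).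
Proof. by elim: b b' => [|[] b IH] [|[] b'] //=; rewrite IH. Qed.

Lemma coef_sum_single bs b : coef (sum_single bs) b = count_mem b bs %[mod 7].
Proof.
elim: bs => //= b' bs IH; rewrite coef_axpy -modnDml IH modnDml coef_single mul1n addnC.
by rewrite eq_sym.
Qed.

Section Invariant.
Variable Q : pred sparse.
Hypothesis Qscale : forall f t, Q t -> Q (scale f t).
Hypothesis Qaxpy : forall f t u, Q t -> Q u -> Q (axpy f t u).

Fixpoint all_pivots (P : tree (option sparse)) :=
  if P is Bin q l r then [&& (if q is Some t then Q t else true), all_pivots l & all_pivots r]
  else true.

Lemma lead_pivot P t b c q : all_pivots P -> lead P t = Some (b, c, Some q) -> Q q.
Proof.
elim: t P b c q => // x l IHl r IHr P b c q QP /=.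
have [Ql Qr Qq] : [/\ all_pivots (if P is Bin _ l _ then l else Tip),
    all_pivots (if P is Bin _ _ r then r else Tip) &
    if P is Bin (Some t) _ _ then Q t else true].
  by case: P QP => [_|[t'|] Pl Pr /=]; [|case/and3P|case/andP].
case: P {QP} Ql Qr Qq => [|o Pl Pr] Ql Qr Qq.
  case el: lead => [[[b1 c1] q1]|]; first by case=> _ _ q1E; rewrite q1E in el; exact: IHl el.
  case er: lead => [[[b1 c1] q1]|]; first by case=> _ _ q1E; rewrite q1E in er; exact: IHr er.
  by case: x.
case el: lead => [[[b1 c1] q1]|]; first by case=> _ _ q1E; rewrite q1E in el; exact: IHl el.
case er: lead => [[[b1 c1] q1]|]; first by case=> _ _ q1E; rewrite q1E in er; exact: IHr er.
by case: x => // x [_ _ oE]; rewrite oE in Qq.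
Qed.

Lemma insert_pivot b q P : Q q -> all_pivots P -> all_pivots (insert b q P).
Proof.
move=> Qq; elim: b P => [|x b IH] [|o l r] /=; rewrite ?Qq //.
- by case/and3P=> _ -> ->.
- by move=> _; case: x => /=; rewrite IH.
by case/and3P=> Qo Ql Qr; case: x; rewrite /= Qo ?Ql ?Qr ?IH.
Qed.

Lemma reduce_pivot n P t : Q t -> all_pivots P -> all_pivots (reduce n P t).
Proof.
elim: n P t => //= n IH P t Qt QP; case e: lead => [[[b c] [q|]]|] //.
  by apply: IH => //; apply: Qaxpy => //; exact: lead_pivot e.
by apply: insert_pivot => //; exact: Qscale.
Qed.

Lemma pivots_all P : all_pivots P -> all (fun x => Q x.2) (pivots P).
Proof.
elim: P => //= o l IHl r IHr /and3P[Qo /IHl Ql /IHr Qr].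
by rewrite !all_cat !all_map Ql Qr; case: o Qo => //= t ->.
Qed.

(** Pivots arise from the rows by [scale] and [axpy] alone. Below, [Q] is membership in the row
    space of a matrix. *)
Lemma gauss_all n rows : all Q rows -> all (fun x => Q x.2) (gauss n rows).
Proof.
move=> Qrows; apply: pivots_all.
suff fold_all P : all_pivots P -> all_pivots (foldl (reduce n) P rows) by apply: fold_all.
elim: rows P Qrows => //= t rows IH P /andP[Qt Qrows] QP.
by apply: IH => //; exact: reduce_pivot.
Qed.
End Invariant.

Section Rows.
Variable m : nat.
Hypothesis m2 : 2 < m.
Notation faces := (faces (tadpole m 3)).

Definition sparse_row j (t : sparse) : 'rV['F_7]_#|faces j| :=
  (\row_s (coef t (bits (face s)))%:R)%R.

Lemma natr_F7 x y : x = y %[mod 7] -> (x%:R = y%:R :> 'F_7)%R.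
Proof. by move=> e; rewrite -(@Fp_nat_mod 7) // e Fp_nat_mod. Qed.

Lemma sparse_row_scale j f t : sparse_row j (scale f t) = (f%:R *: sparse_row j t)%R.
Proof. by apply/rowP => s; rewrite !mxE -natrM; apply: natr_F7; exact: coef_scale. Qed.

Lemma sparse_row_axpy j f t u :
  sparse_row j (axpy f t u) = (sparse_row j t + f%:R *: sparse_row j u)%R.
Proof. by apply/rowP => s; rewrite !mxE -natrM -natrD; apply: natr_F7; exact: coef_axpy. Qed.

Lemma face_wordP j b : face_word m j b -> exists s : 'I_#|faces j|, b = bits (face s).
Proof.
case/and3P => /eqP/bits_nth-> tb cb.
set S := [set i | _] in tb cb *; have /face_surj[s ->] : S \in faces j; last by exists s.
by rewrite inE indep_bits // tb -count_bits.
Qed.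

(** The pivots lie in the row space of [A], and echelon form at positions that are faces makes them
    independent. *)
Lemma check_gauss_rank j rows n p (A : 'M['F_7]_(p, #|faces j|)) :
  all (fun t => sparse_row j t <= A)%MS rows -> check_gauss m j rows n -> n <= \rank A.
Proof.
pose Q t := (sparse_row j t <= A)%MS.
have Qscale f t : Q t -> Q (scale f t) by rewrite /Q sparse_row_scale; exact: scalemx_sub.
have Qaxpy f t u : Q t -> Q u -> Q (axpy f t u).
  by rewrite /Q sparse_row_axpy => Qt Qu; rewrite addmx_sub // scalemx_sub.
move=> /(gauss_all Qscale Qaxpy n.+1); rewrite /check_gauss.
move: (gauss _ rows) => ps allQ /and3P[/andP[nz tri] faceps /eqP <-].
have [->|[s0 _]] : ps = [::] \/ exists s : 'I_#|faces j|, True; [|by []|].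
  case: ps {nz tri allQ} faceps => [|x0 ps0]; [by left|right].
  by case/andP: faceps => /face_wordP[s0 _] _; exists s0.
pose pos (b : bitseq) := odflt s0 [pick s | bits (face s) == b].
have posE b : face_word m j b -> bits (face (pos b)) = b.
  move=> /face_wordP[s sE]; rewrite /pos; case: pickP => [s' /eqP //|/(_ s)].
  by rewrite sE eqxx.
rewrite -(size_map (fun x => (sparse_row j x.2, pos x.1))); apply: triangular_rank.
  rewrite all_map; have : all (predI (fun x => face_word m j x.1)
      (predI (fun x => Q x.2) (fun x => coef x.2 x.1 %% 7 != 0))) ps.
    by rewrite all_predI [X in _ && X]all_predI; apply/and3P.
  apply: sub_all => x /and3P[fx Qx nzx] /=; rewrite [X in X && _]Qx mxE posE //.
  by rewrite -(dvdn_pcharf (pchar_Fp (isT : prime 7))).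
rewrite pairwise_map; apply: sub_in_pairwise faceps tri => x y fx _ /= /eqP xy.
by rewrite mxE posE // xy.
Qed.

Lemma set_nth_bits (S : {set 'I_(m + 3)}) (i : 'I_(m + 3)) x :
  set_nth false (bits S) i x = bits (if x then i |: S else S :\ i).
Proof.
have sz : size (set_nth false (bits S) i x) = m + 3.
  by rewrite size_set_nth size_bits; apply/maxn_idPr.
apply: (@eq_from_nth _ false); rewrite ?size_bits // sz => a aN.
rewrite nth_set_nth /= -[a]/(val (Ordinal aN)) !nth_bits val_eqE.
by case: (x) => /=; rewrite !inE; case: eqVneq.
Qed.

Lemma count_iota (P : pred nat) : count P (iota 0 (m + 3)) = \sum_(i < m + 3) P i.
Proof. by rewrite -val_enum_ord count_map -sum1_count big_enum_cond big_mkcond. Qed.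

Lemma lef_mx_bits j (s : 'I_#|faces j|) (t : 'I_#|faces j.+1|) :
  lef_mx (tadpole m 3) (fun _ => 1%R : 'F_7) j s t
    = (\sum_(i < m + 3) ((i \in face t) && (face t :\ i == face s)))%:R%R.
Proof.
rewrite mxE big_mkcond natr_sum /=; apply: eq_bigr => i _.
by case: (_ && _).
Qed.

Lemma mul_row_lef j (s : 'I_#|faces j|) :
  sparse_row j.+1 (mul_row m (bits (face s))) = row s (lef_mx (tadpole m 3) (fun _ => 1%R) j).
Proof.
apply/rowP => t; rewrite [RHS]mxE lef_mx_bits mxE; apply: natr_F7; rewrite coef_sum_single.
congr (_ %% _); rewrite count_filter count_map count_filter count_iota; apply: eq_bigr => i _ /=.
rewrite (set_nth_bits _ i true) (inj_eq (@bits_inj _)) nth_bits; congr nat_of_bool.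
have [it /=|nit] := boolP (i \in face t); last first.
  case: eqVneq => [e|]; rewrite ?andbF //=.
  by case/negP: nit; rewrite -e !inE eqxx.
apply/idP/eqP => [/andP[/andP[/eqP<- _] nis]|<-]; first by rewrite setU1K.
by rewrite setD1K // eqxx !inE eqxx -indep_bits // andbT; case: (faceP t).
Qed.

Lemma der_row_lef j (t : 'I_#|faces j.+1|) :
  sparse_row j (der_row m (bits (face t)))
    = row t (lef_mx (tadpole m 3) (fun _ => 1%R) j)^T.
Proof.
apply/rowP => s; rewrite [RHS]mxE [RHS]mxE lef_mx_bits mxE; apply: natr_F7.
rewrite coef_sum_single; congr (_ %% _); rewrite count_map count_filter count_iota.
apply: eq_bigr => i _ /=.
by rewrite (set_nth_bits _ i false) (inj_eq (@bits_inj _)) nth_bits andbC.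
Qed.

Variable k : fieldType.
Hypothesis k0 : ([pchar k] =i pred0)%R.
Notation M := (lef_mx (tadpole m 3) (fun _ => 1%R : k)).

Lemma rank_lef_F7 j :
  \rank (lef_mx (tadpole m 3) (fun _ => 1%R : 'F_7) j) <= \rank (M j).
Proof.
have mapE (F : fieldType) : lef_mx (tadpole m 3) (fun _ => 1%R : F) j
    = map_mx intr (lef_mx (tadpole m 3) (fun _ => 1%R : int) j).
  by apply/matrixP => s t; rewrite !mxE rmorph_sum.
by rewrite !mapE; exact: rank_map_intr_le.
Qed.

Lemma all_face_words j (P : pred sparse) (f : bitseq -> sparse) :
  (forall s : 'I_#|faces j|, P (f (bits (face s)))) -> all P (map f (face_words m j)).
Proof.
move=> Pf; rewrite all_map; apply/allP => b; rewrite mem_filter => /andP[/face_wordP[s ->] _].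
exact: Pf.
Qed.

Lemma inj_check_rank j : inj_check m j -> \rank (M j) = #|faces j|.
Proof.
rewrite /inj_check -card_faces_tadpole // => chk.
apply/eqP; rewrite eqn_leq rank_leq_row /=.
apply: leq_trans (rank_lef_F7 j); apply: check_gauss_rank chk; apply: all_face_words => s.
by rewrite mul_row_lef row_sub.
Qed.

Lemma surj_check_rank j : surj_check m j -> \rank (M j) = #|faces j.+1|.
Proof.
rewrite /surj_check -card_faces_tadpole // => chk.
apply/eqP; rewrite eqn_leq rank_leq_col /=.
apply: leq_trans (rank_lef_F7 j); rewrite -mxrank_tr.
apply: check_gauss_rank chk.
by apply: all_face_words => s; rewrite der_row_lef row_sub.
Qed.

Definition wlp_check :=
  all (fun j => if tadpole_count m j <= tadpole_count m j.+1 then inj_check m j else surj_check m j)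
    (iota 0 (size (tadpole_countN m))).

Lemma wlp_check_has_WLP : wlp_check -> has_WLP k (m + 3) (tadpole m 3).
Proof.
move=> /allP chk; apply/(has_WLP_rank _ k0) => j /=.
have [jn|nj] := ltnP j (size (tadpole_countN m)).
  have := chk j; rewrite mem_iota jn => /(_ isT).
  by case: ifP => _ => [/inj_check_rank->|/surj_check_rank->]; rewrite eqxx ?orbT.
(* Past the list of counts the target is zero, so surjectivity is automatic. *)
have f0 : #|faces j.+1| = 0.
  by rewrite card_faces_tadpole // tadpole_countNE /valN nth_default // ltnW.
by move: (\rank (M j)) (rank_leq_col (M j)) => r; rewrite f0 leqn0 => ->; rewrite orbT.
Qed.

End Rows.

(** * The tadpoles without the weak Lefschetz property *)

Definition tadpole_free m (vs : seq nat) b := all (apart (tadpole_adj m) b) vs.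

(* The first vertices are chosen in decreasing order below [v]; the partner of [a]
   is the smallest later vertex that is compatible with the previous pairs. *)
Fixpoint pairings m v d (ps : seq (nat * nat)) : seq (seq (nat * nat)) :=
  if v is a.+1 then
    (let vs := unzip1 ps ++ unzip2 ps in
     if tadpole_free m vs a then
       if [seq b <- iota v (m + 3 - v) | tadpole_free m vs b] is b :: _ then
         let ps' := (a, b) :: ps in
         if d is d'.+1 then pairings m a d' ps' else [:: ps']
       else [::]
     else [::]) ++ pairings m a d ps
  else [::].

(* The order is reversed because moving a first vertex to its partner increases
   the monomial. *)
Definition special_pairings m c := rev (take c (pairings m (m + 3) (m %/ 3) [::])).

(** The last clause bounds the growth of the dimension by [c - 1], which gives the strict inequality
    required by [pairings_not_WLP]. *)
Definition special_check m c :=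
  let L := special_pairings m c in
  [&& all (all (fun p => (p.1 < m + 3) && (p.2 < m + 3))) L,
      all (pairing (tadpole_adj m) (m %/ 3).+1) L, unitriangular L, size L == c
    & count_leN m (m %/ 3) (BinNat.N.of_nat c.-1)].

Section Negative.
Variables (k : fieldType) (m : nat).
Hypotheses (k0 : ([pchar k] =i pred0)%R) (m2 : 2 < m).

Lemma special_not_WLP c : 0 < c -> special_check m c -> ~ has_WLP k (m + 3) (tadpole m 3).
Proof.
move=> c0 /and5P[bL pL tL /eqP szL /count_leNP le].
apply: (pairings_not_WLP k0 bL pL tL); rewrite szL // -tadpoleE !card_faces_tadpole //.
by apply: leq_ltn_trans le _; lia.
Qed.

Definition matching : seq (nat * nat) :=
  [seq (3 * i, 3 * i + 1) | i <- iota 0 (m %/ 3)] ++ [:: (m + 1, m + 2)].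

(** The only edge between nonconsecutive numbers is the closing one, with larger end [m - 1]. *)
Lemma apart_far a b : a.+1 < b -> b != m.-1 -> apart (tadpole_adj m) a b.
Proof.
move=> ab bm; apply/and3P; split; first by lia.
  by rewrite /tadpole_adj /tadpole_edge; lia.
by rewrite /tadpole_adj /tadpole_edge; lia.
Qed.

Lemma pairing_matching : pairing (tadpole_adj m) (m %/ 3).+1 matching.
Proof.
have lead1 : unzip1 matching = [seq 3 * i | i <- iota 0 (m %/ 3)] ++ [:: m + 1].
  by rewrite /unzip1 map_cat -map_comp.
apply/and4P; split.
- by rewrite size_cat size_map size_iota /= addn1 eqxx.
- rewrite lead1 cat_uniq map_inj_uniq ?iota_uniq /= => [|x y]; last by lia.
  by rewrite orbF andbT; apply/mapP => -[i]; rewrite mem_iota; lia.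
- rewrite pairwise_cat /= andbT allrel1r all_map pairwise_map; apply/andP; split.
    apply/allP => i; rewrite mem_iota /separated /= => iq.
    by rewrite !apart_far //; lia.
  apply: (@sub_in_pairwise _ [pred i | i < m %/ 3] ltn).
  + move=> i j; rewrite !inE => iq jq /= ij.
    by rewrite /separated /= !apart_far //; lia.
  + by apply/allP => i; rewrite mem_iota.
  + by rewrite -sorted_pairwise ?iota_ltn_sorted //; exact: ltn_trans.
apply/allP => p pM; rewrite /= !inE /= (map_f fst pM) addTb lead1 mem_cat negb_or.
move: pM; rewrite mem_cat !inE => /orP[/mapP[i] | /eqP->] /=.
  rewrite mem_iota => iq -> /=; apply/andP; split; last by lia.
  by apply/mapP => -[j]; lia.
by apply/andP; split; [apply/mapP => -[j]; rewrite mem_iota|]; lia.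
Qed.

Lemma matching_not_WLP : tadpole_count m (m %/ 3).+1 <= tadpole_count m (m %/ 3) ->
  ~ has_WLP k (m + 3) (tadpole m 3).
Proof.
move=> le; rewrite tadpoleE.
apply: (@pairings_not_WLP _ (tadpole_adj m) k (m %/ 3) [:: matching]) => //.
- rewrite /= andbT; apply/allP => p; rewrite mem_cat inE => /orP[/mapP[i]|/eqP->] /=.
    by rewrite mem_iota => iq -> /=; lia.
  by lia.
- by rewrite /= andbT pairing_matching.
by rewrite -tadpoleE !card_faces_tadpole //= addn1 ltnS.
Qed.
End Negative.

Lemma special_check_13 : special_check 13 33.
Proof. by vm_compute. Qed.

Lemma special_check_17 : special_check 17 395.
Proof. by vm_compute. Qed.

(* Lazily, [take] stops the search after 106 of the 767 pairings. *)
Lemma special_check_20 : special_check 20 106.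
Proof. by lazy. Qed.

Lemma wlp_check_true : all wlp_check [:: 3; 4; 5; 6; 7; 8; 10; 11; 14].
Proof. by vm_compute. Qed.

Local Open Scope ring_scope.

Theorem theorem4p2 (k : fieldType) (m : nat) :
  [pchar k]%R =i pred0 -> (3 <= m)%N ->
  has_WLP k (m + 3) (tadpole m 3) <-> m \in [:: 3; 4; 5; 6; 7; 8; 10; 11; 14]%N.
Proof.
move=> k0 m2; split=> [wlp|mP]; last first.
  exact: (wlp_check_has_WLP m2 k0 (allP wlp_check_true _ mP)).
apply: contraPT wlp => mP; have [m44|m44] := ltnP 44 m.
  exact: matching_not_WLP k0 m2 (tadpole_count_large m44).
have [mS|] := boolP (m \in [:: 9; 12; 15; 16; 18; 19] ++ iota 21 24).
  exact: matching_not_WLP k0 m2 (tadpole_count_small mS).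
rewrite mem_cat mem_iota => mS.
have : m \in [:: 13; 17; 20] by move: mP mS; rewrite !inE; lia.
rewrite !inE => /or3P[] /eqP->.
- exact: (@special_not_WLP k 13 k0 isT 33 isT special_check_13).
- exact: (@special_not_WLP k 17 k0 isT 395 isT special_check_17).
exact: (@special_not_WLP k 20 k0 isT 106 isT special_check_20).
Qed.
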